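(* Let $F$ be a field and let $L$ be a supersolvable Lie algebra over $F$ of finite dimension $n$ with $\alpha(L) = n-2$. Then $\beta(L) = n-2$.
   Context: For a finite-dimensional Lie algebra $L$ over a field $F$: $\alpha(L)$ is the maximum of $\dim A$ over abelian subalgebras $A$ of $L$, and $\beta(L)$ is the maximum of $\dim B$ over abelian ideals $B$ of $L$. $L$ is supersolvable if there is a chain $0=L_0 \subset L_1 \subset \cdots \subset L_{n-1} \subset L_n = L$ where each $L_i$ is an $i$-dimensional ideal of $L$. *)

(* Defs.v *)
From HB Require Import structures.
From mathcomp Require Import all_boot all_algebra.
From mathcomp Require Import boolp.

Set Implicit Arguments.
Unset Strict Implicit.
Unset Printing Implicit Defensive.

Import GRing.Theory.
Local Open Scope ring_scope.

(* Finite-dimensional Lie algebras; the bracket is required to be alternating,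
   which is stronger than antisymmetric in characteristic 2. *)
HB.mixin Record hasLieBracket (F : fieldType) L of Vector F L := {
  lie : L -> L -> L;
  lie_linearl : forall y : L, linear (fun x : L => lie x y);
  lie_linearr : forall x : L, linear (lie x);
  liexx : forall x : L, lie x x = 0;
  lie_jacobi : forall x y z : L,
    lie x (lie y z) + lie y (lie z x) + lie z (lie x y) = 0
}.

#[short(type="lieAlgType")]
HB.structure Definition LieAlgebra (F : fieldType) :=
  {L of Vector F L & hasLieBracket F L}.

Definition subalgebra (F : fieldType) (L : lieAlgType F) (A : {vspace L}) :=
  forall x y : L, x \in A -> y \in A -> lie x y \in A.

Definition ideal (F : fieldType) (L : lieAlgType F) (I : {vspace L}) :=
  forall x y : L, y \in I -> lie x y \in I.

Definition abelian_space (F : fieldType) (L : lieAlgType F) (A : {vspace L}) :=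
  forall x y : L, x \in A -> y \in A -> lie x y = 0.

Definition max_dim (F : fieldType) (L : vectType F) (P : {vspace L} -> Prop) : nat :=
  \max_(k < (\dim {:L}).+1 | `[< exists2 A : {vspace L}, P A & \dim A = k >]) k.

(* The default value 0 of the empty maximum is not used for the invariants
   below, because the zero space satisfies P. *)
Lemma max_dimP (F : fieldType) (L : vectType F) (P : {vspace L} -> Prop) :
  P 0%VS ->
  (exists2 A : {vspace L}, P A & \dim A = max_dim P) /\
  (forall A : {vspace L}, P A -> (\dim A <= max_dim P)%N).
Proof.
move=> P0; split; last first.
  move=> A PA; have Ale : (\dim A < (\dim {:L}).+1)%N by rewrite ltnS dimvS ?subvf.
  by apply: (@leq_bigmax_cond _ _ _ (Ordinal Ale)); apply/asboolP; exists A.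
rewrite /max_dim; elim/big_ind: _ => [|m n Hm Hn|k /asboolP//].
  by exists 0%VS; rewrite ?dimv0.
by case: (leqP m n).
Qed.

Definition alpha (F : fieldType) (L : lieAlgType F) : nat :=
  max_dim (fun A : {vspace L} => subalgebra A /\ abelian_space A).

Definition beta (F : fieldType) (L : lieAlgType F) : nat :=
  max_dim (fun B : {vspace L} => ideal B /\ abelian_space B).

Definition supersolvable (F : fieldType) (L : lieAlgType F) : Prop :=
  let n := \dim {:L} in
  exists c : nat -> {vspace L},
    [/\ c 0%N = 0%VS,
        c n = fullv,
        forall i, (i < n)%N -> (c i <= c i.+1)%VS
      & forall i, (i <= n)%N -> ideal (c i) /\ \dim (c i) = i].

Lemma abelian_subalgebra0 (F : fieldType) (L : lieAlgType F) :
  subalgebra (0%VS : {vspace L}) /\ abelian_space (0%VS : {vspace L}).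
Proof.
have H (x y : L) : x \in 0%VS -> lie x y = 0.
  by rewrite memv0 => /eqP->; have := lie_linearl y (-1) 0 0;
    rewrite /= !scaleN1r oppr0 addr0 addNr.
by split=> x y /(H _ y) // ->; rewrite mem0v.
Qed.

Lemma abelian_ideal0 (F : fieldType) (L : lieAlgType F) :
  ideal (0%VS : {vspace L}) /\ abelian_space (0%VS : {vspace L}).
Proof.
split; last exact: (abelian_subalgebra0 L).2.
move=> x y; rewrite memv0 => /eqP->; have := lie_linearr x (-1) 0 0.
by rewrite /= !scaleN1r oppr0 addr0 addNr => ->; rewrite mem0v.
Qed.

(* Main.v *)
(* If Z <= K are ideals with [Z, K] = 0, an ideal I of L with Z < I <= K and
   dim I = dim Z + 1, found in the flag, is abelian when Z is.  Hence an abelian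
   ideal of codimension 3 that does not contain its centraliser can be enlarged.
   If A is abelian of codimension 1 in an ideal K of L, then A is an ideal of L or
   the centre of K has codimension at most 2 in K; in both cases K contains an
   abelian ideal of L of dimension dim A.

   Let A be abelian of codimension 2.  The flag gives a subalgebra M > A of
   codimension 1 which we may assume is not an ideal, and an ideal P <= M with
   P + <z> an ideal, z not in M.  Then C = {y in M | [z, y] in P} is an ideal of
   codimension 1 in M.  We may assume that C is not abelian and that there is m in
   A outside C.  If B = A :&: C is an ideal, it is centralised by m, hence can be
   enlarged.  Otherwise the centre Z of C has codimension 1 in B and is central in
   L, since its centraliser is an ideal strictly larger than M; now an abelian
   ideal I = Z + <e> <= C is centralised by a vector outside I obtained from m, z
   and some b in B. *)
Require Import Defs.
From HB Require Import structures.
From mathcomp Require Import all_boot all_algebra.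
From mathcomp Require Import boolp zify.

Set Implicit Arguments.
Unset Strict Implicit.
Unset Printing Implicit Defensive.

Import GRing.Theory.
Local Open Scope ring_scope.

(** * Linear algebra: adjoining one vector, dimensions of preimages *)

Section VectorSpaces.
Variables (F : fieldType) (V : vectType F).
Implicit Types (U W X : {vspace V}) (f : 'End(V)).

Lemma dimv_addv_line U v : v \notin U -> \dim (U + <[v]>) = (\dim U).+1.
Proof.
move=> nvU; have v0 : v != 0 by apply: contraNneq nvU => ->; rewrite mem0v.
rewrite dimv_disjoint_sum ?dim_vline ?v0 ?addn1 //; apply/eqP; rewrite -subv0.
apply/subvP => w; rewrite memv_cap => /andP[+ /vlineP[k def_w]]; rewrite def_w.
by rewrite rpredZeq (negPf nvU) orbF => /eqP->; rewrite scale0r mem0v.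
Qed.

Lemma eq_addv_line U W v :
    (U <= W)%VS -> v \in W -> v \notin U -> (\dim W <= (\dim U).+1)%N ->
  W = (U + <[v]>)%VS.
Proof.
move=> UW vW nvU dW; apply/esym/eqP.
by rewrite eqEdim subv_add UW -memvE vW /= dimv_addv_line.
Qed.

Lemma memv_addv_lineP U v w :
  reflect (exists k, w - k *: v \in U) (w \in (U + <[v]>)%VS).
Proof.
apply: (iffP memv_addP) => [[u uU [_ /vlineP[k ->] ->]]|[k wU]].
  by exists k; rewrite addrK.
by exists (w - k *: v) => //; exists (k *: v); rewrite ?subrK ?memvZ ?memv_line.
Qed.

(** Rank-nullity for [g \o f] on [U], where [g] has kernel [W]: the image lies in [g @: X], of
    dimension [\dim X - \dim W]. *)
Lemma dimv_cap_preim f U W X :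
    (f @: U <= X)%VS -> (W <= X)%VS ->
  (\dim U + \dim W <= \dim (U :&: f @^-1: W) + \dim X)%N.
Proof.
move=> fUX WX; pose g : 'End(V) := (\1 - projv W)%VF.
have kerg : lker g = W.
  apply/vspaceP => v; rewrite memv_ker add_lfunE opp_lfunE id_lfunE subr_eq0.
  apply/eqP/idP => [->|vW]; first exact: memv_proj.
  by rewrite projv_id.
have dX := limg_ker_dim g X; have dU := limg_ker_dim (g \o f) U.
rewrite kerg (capv_idPr WX) in dX.
have sgf : (\dim ((g \o f) @: U) <= \dim (g @: X))%N by rewrite dimvS // limg_comp limgS.
have -> : (f @^-1: W)%VS = lker (g \o f).
  apply/vspaceP => v.
  by rewrite -memv_preim memv_ker comp_lfunE -memv_ker kerg.
by lia.
Qed.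

End VectorSpaces.

(** * Bracket identities, centralisers, ideals and the flag *)

Section LieAlgebras.
Variables (F : fieldType) (L : lieAlgType F).
Implicit Types (x y z : L) (A I J K U Z : {vspace L}).

HB.instance Definition _ x :=
  GRing.isLinear.Build F L L *:%R (lie x) (lie_linearr x).

Lemma lieDl x y z : lie (x + y) z = lie x z + lie y z.
Proof. by have /= := lie_linearl z 1 x y; rewrite !scale1r. Qed.

Lemma lieC x y : lie x y = - lie y x.
Proof.
apply/eqP; rewrite -addr_eq0; apply/eqP.
by have := liexx (x + y); rewrite lieDl !raddfD /= !liexx add0r addr0.
Qed.

Lemma lie_derivation x y z : lie x (lie y z) = lie (lie x y) z + lie y (lie x z).
Proof.
have /eqP := lie_jacobi x y z; rewrite -addrA addr_eq0 => /eqP ->.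
by rewrite (lieC z x) raddfN /= (lieC z) opprD !opprK addrC.
Qed.

Lemma lieZl k x y : lie (k *: x) y = k *: lie x y.
Proof. by rewrite lieC linearZ /= -scalerN -lieC. Qed.

Lemma lieBl x y z : lie (x - y) z = lie x z - lie y z.
Proof. by rewrite -scaleN1r lieDl lieZl scaleN1r. Qed.

Definition ad x : 'End(L) := linfun (lie x).

(** A finite intersection of kernels over a basis of [K], so that the centraliser is itself a
    [{vspace L}]. *)
Definition centraliser K : {vspace L} :=
  (\bigcap_(i < \dim K) lker (ad (vbasis K)`_i))%VS.

Lemma memv_ad_preim x y K : (y \in ad x @^-1: K)%VS = (lie x y \in K).
Proof. by rewrite -memv_preim lfunE. Qed.

Lemma centraliserP x K :
  reflect (forall y, y \in K -> lie x y = 0) (x \in centraliser K).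
Proof.
rewrite memvE; apply: (iffP subv_bigcapP) => [xC y yK | xC i _].
  rewrite (coord_vbasis yK) raddf_sum big1 // => i _.
  have := xC i isT; rewrite -memvE memv_ker lfunE /= => /eqP xi.
  by rewrite linearZ /= lieC xi oppr0 scaler0.
rewrite -memvE memv_ker lfunE /= lieC xC ?oppr0 //.
by rewrite vbasis_mem ?mem_nth ?size_tuple.
Qed.

Lemma idealCr I x y : ideal I -> x \in I -> lie x y \in I.
Proof. by move=> idI xI; rewrite lieC memvN idI. Qed.

Lemma ideal_cap I J : ideal I -> ideal J -> ideal (I :&: J)%VS.
Proof.
by move=> idI idJ x y; rewrite !memv_cap => /andP[yI yJ]; rewrite idI ?idJ.
Qed.

Lemma ideal_add I J : ideal I -> ideal J -> ideal (I + J)%VS.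
Proof.
move=> idI idJ x _ /memv_addP[u uI [v vJ ->]].
by rewrite raddfD memv_add ?idI ?idJ.
Qed.

Lemma subalgebra_add A I : subalgebra A -> ideal I -> subalgebra (A + I)%VS.
Proof.
move=> sA idI x y /memv_addP[a aA [u uI ->]] /memv_addP[b bA [v vI ->]].
rewrite lieDl !raddfD /= -addrA memv_add ?sA //.
by apply: memvD; [|apply: memvD]; [apply: idI | apply: idealCr | apply: idI].
Qed.

Lemma ideal_centraliser I : ideal I -> ideal (centraliser I).
Proof.
move=> idI x y /centraliserP yC; apply/centraliserP => z zI.
by have := lie_derivation x y z; rewrite !yC ?idI // raddf0 addr0.
Qed.

Lemma abelian_addv_line A x :
  abelian_space A -> x \in centraliser A -> abelian_space (A + <[x]>)%VS.
Proof.
move=> abA /centraliserP xA y z.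
move=> /memv_addP[a aA [_ /vlineP[k ->] ->]] /memv_addP[b bA [_ /vlineP[l ->] ->]].
have xC c t : c \in A -> lie c (t *: x) = 0.
  by move=> cA; rewrite linearZ /= lieC xA // oppr0 scaler0.
rewrite raddfD /= !lieDl abA // xC // (lieC _ b) xC // linearZ /= (lieC _ x).
by rewrite linearZ /= liexx scaler0 !oppr0 scaler0 !addr0.
Qed.

(* J is the last term of the flag with K :&: J inside U, and J + <w> is the next
   term. *)
Lemma supersolvable_step K U :
    supersolvable L -> ~~ (K <= U)%VS ->
  exists J w, [/\ ideal J, ideal (J + <[w]>)%VS, w \in K, w \notin U
                & (K :&: J <= U)%VS].
Proof.
case=> c [c0 cn cS c_id] KU; set n := \dim {:L} in cn cS c_id.
pose P i := ~~ (K :&: c i <= U)%VS.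
have exP : exists i, P i by exists n; rewrite /P cn capvf.
case: (ex_minnP exP) => -[|i] Pi i_min.
  by move: Pi; rewrite /P c0 capv0 sub0v.
have ltin : (i < n)%N by apply: i_min; rewrite /P cn capvf.
have [idJ dJ] := c_id i (ltnW ltin); have [idJ1 dJ1] := c_id _ ltin.
have sJ : (K :&: c i <= U)%VS.
  by apply/negPn/negP => /i_min; rewrite ltnn.
have /subvPn[w] := Pi; rewrite memv_cap => /andP[wK wc] nwU.
exists (c i), w; rewrite -(@eq_addv_line _ _ (c i) (c i.+1)) ?cS ?dJ ?dJ1 //.
by apply: contra nwU => wci; rewrite (subvP sJ) // memv_cap wK.
Qed.

(** * Abelian ideals from abelian subspaces of small codimension *)

Lemma central_extension Z K x :
    supersolvable L -> ideal Z -> ideal K -> (Z <= K)%VS ->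
    (K <= centraliser Z)%VS -> x \in K -> x \notin Z ->
  exists I, [/\ ideal I, abelian_space I, (Z <= I)%VS, (I <= K)%VS
              & \dim I = (\dim Z).+1].
Proof.
move=> ssL idZ idK ZK KZ xK nxZ.
have KnZ : ~~ (K <= Z)%VS by apply/subvPn; exists x.
have [J [w [idJ idJw wK nwZ KJ]]] := supersolvable_step ssL KnZ.
exists (Z + <[w]>)%VS; split; rewrite ?addvSl ?dimv_addv_line //.
(* The right-hand side is a sum of ideals; it adds only [w] to [Z] because [K :&: J] lies in [Z]. *)
- have -> : (Z + <[w]> = Z + (K :&: (J + <[w]>)))%VS.
    apply/eqP; rewrite eqEsubv !subv_add !addvSl /= -!memvE.
    rewrite (subvP (addvSr _ _)) /=; last first.
      by rewrite memv_cap wK (subvP (addvSr _ _)) ?memv_line.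
    apply/subvP => v; rewrite memv_cap => /andP[vK /memv_addv_lineP[k vJ]].
    apply/memv_addv_lineP; exists k; apply: (subvP KJ).
    by rewrite memv_cap vJ memvB ?memvZ.
  by apply: ideal_add => //; apply: ideal_cap.
- apply: abelian_addv_line; last exact: (subvP KZ).
  by move=> y z yZ zZ; have /(subvP ZK)/(subvP KZ)/centraliserP-> := yZ.
- by rewrite subv_add ZK -memvE.
Qed.

(* If [u, b] = x is outside A with b in A, then K = A + <x>, and for a in A with
   [u, a] in A the Jacobi identity applied to [u, [a, b]] = 0 gives [a, x] = 0. *)
Lemma codim1_abelian_center K A :
    ideal K -> (A <= K)%VS -> abelian_space A -> \dim K = (\dim A).+1 ->
    ~ ideal A ->
  (\dim A <= (\dim (K :&: centraliser K)).+1)%N.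
Proof.
move=> idK AK abA dK nidA.
have [u [b [bA nubA]]] : exists u b, b \in A /\ lie u b \notin A.
  apply: contrapT => noub; apply: nidA => u b bA; apply/negPn/negP => ?.
  by apply: noub; exists u, b.
have defK : K = (A + <[lie u b]>)%VS.
  by apply: eq_addv_line; rewrite ?dK // idK // (subvP AK).
(* [ad u] maps [A] into [K], where [A] has codimension 1, so [N] has codimension at most 1 in
   [A]. *)
pose N := (A :&: ad u @^-1: A)%VS.
have dN : (\dim A + \dim A <= \dim N + \dim K)%N.
  apply: dimv_cap_preim => //; apply/subvP => _ /memv_imgP[a aA ->].
  by rewrite lfunE idK ?(subvP AK).
suffices /dimvS : (N <= K :&: centraliser K)%VS by lia.
apply/subvP => a; rewrite !memv_cap memv_ad_preim => /andP[aA uaA].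
rewrite (subvP AK) //=; apply/centraliserP => y.
rewrite defK => /memv_addP[c cA [_ /vlineP[k ->] ->]].
rewrite raddfD /= linearZ /= abA // add0r.
have := lie_derivation u a b; rewrite (abA a b) // raddf0 (abA _ b) // add0r.
by move<-; rewrite scaler0.
Qed.

Lemma codim1_abelian_ideal K A :
    supersolvable L -> ideal K -> (A <= K)%VS -> abelian_space A ->
    \dim K = (\dim A).+1 ->
  exists I, [/\ ideal I, abelian_space I & (\dim A <= \dim I)%N].
Proof.
move=> ssL idK AK abA dK; have [idA|nidA] := pselect (ideal A); first by exists A.
have := codim1_abelian_center idK AK abA dK nidA.
set Z := (K :&: centraliser K)%VS => dZ.
have idZ : ideal Z by apply: ideal_cap => //; apply: ideal_centraliser.
have abZ : abelian_space Z.
  by move=> y z; rewrite !memv_cap => /andP[_ /centraliserP yC] /andP[/yC ->].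
have [dAZ|dZA] := leqP (\dim A) (\dim Z); first by exists Z.
have /subvPn[x xK nxZ] : ~~ (K <= Z)%VS.
  by apply: contraL dZA => /dimvS; lia.
have KZ : (K <= centraliser Z)%VS.
  apply/subvP => y yK; apply/centraliserP => z.
  by rewrite memv_cap => /andP[_ /centraliserP zC]; rewrite lieC zC ?oppr0.
have [I [idI abI _ _ dI]] := central_extension ssL idZ idK (capvSl _ _) KZ xK nxZ.
by exists I; rewrite dI.
Qed.

Lemma codim2_abelian_ideal A :
    supersolvable L -> abelian_space A -> \dim {:L} = (\dim A).+2 ->
  exists I, [/\ ideal I, abelian_space I & (\dim A <= \dim I)%N].
Proof.
move=> ssL abA dL; apply: contrapT => no_ideal.
have {}no_ideal I : ideal I -> abelian_space I -> (\dim I < \dim A)%N.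
  by move=> idI abI; rewrite ltnNge; apply/negP => ?; apply: no_ideal; exists I.
have nfull U : (\dim U < \dim {:L})%N -> ~~ (fullv <= U)%VS.
  by rewrite ltnNge; apply: contra; apply: dimvS.
have [|J [w [idJ idJw _ nwA]]] := @supersolvable_step fullv A ssL.
  by apply: nfull; rewrite dL; lia.
rewrite capfv => JA; pose M := (A + <[w]>)%VS.
have dM : \dim M = (\dim A).+1 by rewrite dimv_addv_line.
have AM : (A <= M)%VS := addvSl _ _.
have subM : subalgebra M.
  have -> : M = (A + (J + <[w]>))%VS by rewrite addvA (addv_idPl JA).
  by apply: subalgebra_add => // x y xA yA; rewrite abA ?mem0v.
have nidM : ~ ideal M.
  move=> idM; have [I [idI abI]] := codim1_abelian_ideal ssL idM AM abA dM.
  by rewrite leqNgt no_ideal.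
have [|P [z [idP idPz _ nzM]]] := @supersolvable_step fullv M ssL.
  by apply: nfull; rewrite dL dM.
rewrite capfv => PM; pose C := (M :&: ad z @^-1: P)%VS.
have memC x : (x \in C) = (x \in M) && (lie z x \in P).
  by rewrite memv_cap memv_ad_preim.
have CM : (C <= M)%VS := capvSl _ _.
(* Write [z, [x, c]] = [[z, x], c] + [x, [z, c]]. The last term is in [P], and so is the other,
   since [z, x] is in [P + <[z]>] and [z, c] in [P]. *)
have idC : ideal C.
  have defL : fullv = (M + <[z]>)%VS.
    by apply: eq_addv_line; rewrite ?subvf ?memvf ?dL ?dM.
  move=> x c; rewrite !memC => /andP[cM zcP]; apply/andP; split.
    have /memv_addP[y yM [_ /vlineP[k ->] ->]] : x \in (M + <[z]>)%VS.
      by rewrite -defL memvf.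
    by rewrite lieDl lieZl memvD ?subM // memvZ // (subvP PM).
  rewrite lie_derivation; apply: memvD; last exact: idP.
  have : lie z x \in (P + <[z]>)%VS by rewrite idealCr ?(subvP (addvSr _ _)) ?memv_line.
  case/memv_addP => p pP [_ /vlineP[k ->] ->].
  by rewrite lieDl lieZl memvD ?memvZ // idealCr.
(* [ad z] maps [M] into [P + <[z]>], so [C] has codimension at most 1 in [M]; codimension 0 would
   make [M] an ideal. *)
have dC : \dim C = \dim A.
  have nzP : z \notin P by apply: contra nzM; apply: (subvP PM).
  have : (\dim M + \dim P <= \dim C + \dim (P + <[z]>))%N.
    apply: dimv_cap_preim; last exact: addvSl.
    apply/subvP => _ /memv_imgP[x _ ->]; rewrite lfunE.
    by rewrite idealCr ?(subvP (addvSr _ _)) ?memv_line.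
  have : (\dim C < \dim M)%N.
    rewrite ltnNge; apply/negP => dMC; apply: nidM.
    by have /eqP <- : C == M by rewrite eqEdim CM.
  by rewrite dimv_addv_line //; lia.
have /subvPn[m mA nmC] : ~~ (A <= C)%VS.
  apply/negP => sAC; have /eqP defA : A == C by rewrite eqEdim sAC dC /=.
  have idA : ideal A by rewrite defA.
  by have := no_ideal A idA abA; rewrite ltnn.
pose B := (A :&: C)%VS.
have [BA BC] : (B <= A)%VS /\ (B <= C)%VS by rewrite capvSl capvSr.
have abB : abelian_space B.
  by move=> x y /(subvP BA) xA /(subvP BA) yA; apply: abA.
have nmB : m \notin B by apply: contra nmC; apply: (subvP BC).
(* [A] and [C] are distinct hyperplanes of [M]. *)
have dB : \dim A = (\dim B).+1.
  have : (\dim (A + C) <= \dim M)%N by rewrite dimvS // subv_add AM.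
  rewrite dM -addn1 -(leq_add2r (\dim B)) dimv_sum_cap dC addnAC -addnA.
  rewrite leq_add2l addn1 => dAB; apply/eqP; rewrite eqn_leq dAB ltnNge.
  apply: contra nmB => dBA.
  by have /eqP -> : B == A by rewrite eqEdim BA.
(* Otherwise [central_extension] inside the centraliser of [I] gives an abelian ideal of dimension
   [\dim A]. *)
have extend I v : ideal I -> abelian_space I -> \dim A = (\dim I).+1 ->
    v \in centraliser I -> v \in I.
  move=> idI abI dI vI; apply/negPn/negP => nvI.
  have Iab : (I <= centraliser I)%VS.
    by apply/subvP => x xI; apply/centraliserP => y; apply: abI.
  have [K [idK abK _ _ dK]] :=
    central_extension ssL idI (ideal_centraliser idI) Iab (subvv _) vI nvI.
  by have := no_ideal K idK abK; rewrite dI dK ltnn.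
have nidB : ~ ideal B.
  move=> idB; case/negP: nmB; apply: extend => //.
  by apply/centraliserP => y /(subvP BA); apply: abA.
have nabC : ~ abelian_space C by move/(no_ideal C idC); rewrite dC ltnn.
pose Z := (C :&: centraliser C)%VS.
have dZ : (\dim B <= (\dim Z).+1)%N.
  by apply: codim1_abelian_center; rewrite ?dC.
have idZ : ideal Z by apply: ideal_cap => //; apply: ideal_centraliser.
have ZC : (Z <= C)%VS := capvSl _ _.
(* An element of [Z] outside [B] would make [C], which is [B] plus its line, abelian. *)
have ZB : (Z <= B)%VS.
  apply/subvP => x; rewrite memv_cap => /andP[xC /centraliserP cxC].
  apply/negPn/negP => nxB; apply: nabC.
  rewrite (@eq_addv_line _ _ B C x) ?dC ?dB //.
  apply: abelian_addv_line => //; apply/centraliserP => y /(subvP BC).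
  exact: cxC.
have {}dZ : \dim B = (\dim Z).+1.
  apply/eqP; rewrite eqn_leq dZ ltnNge; apply/negP => dBZ; apply: nidB.
  by have /eqP <- : Z == B by rewrite eqEdim ZB.
have CcZ : (C <= centraliser Z)%VS.
  apply/subvP => x xC; apply/centraliserP => y.
  by rewrite memv_cap => /andP[_ /centraliserP yC]; rewrite lieC yC ?oppr0.
(* The centraliser of [Z] is an ideal containing [C] and [m], hence the hyperplane [M]; as [M] is
   not an ideal, it is all of [L]. *)
have ZcentL x y : y \in Z -> lie x y = 0.
  move=> yZ; suffices cZ : (fullv <= centraliser Z)%VS.
    by move/centraliserP: (subvP cZ x (memvf x)); apply.
  have defM : M = (C + <[m]>)%VS.
    by apply: eq_addv_line; rewrite ?dM ?dC // (subvP AM).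
  have McZ : (M <= centraliser Z)%VS.
    rewrite defM subv_add CcZ -memvE; apply/centraliserP => t /(subvP ZB).
    by move/(subvP BA); apply: abA.
  apply/negPn/negP => ncZ; apply: nidM.
  suffices /eqP-> : M == centraliser Z by apply: ideal_centraliser.
  rewrite eqEdim McZ dM leqNgt; apply: contra ncZ => ltZ.
  have /eqP-> : centraliser Z == fullv by rewrite eqEdim subvf dL.
  exact: subvv.
have [b0 b0B nb0Z] : exists2 b, b \in B & b \notin Z.
  by apply/subvPn/negP => /dimvS; rewrite dZ ltnn.
have [I [idI abI ZI IC dI]] :=
  central_extension ssL idZ idC ZC CcZ (subvP BC _ b0B) nb0Z.
have [e eI neZ] : exists2 e, e \in I & e \notin Z.
  by apply/subvPn/negP => /dimvS; rewrite dI ltnn.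
have defI : I = (Z + <[e]>)%VS by apply: eq_addv_line; rewrite ?dI.
have cent_e v : lie v e = 0 -> v \in I.
  move=> ve; apply: extend => //; first by rewrite dI -dZ.
  apply/centraliserP => y; rewrite defI => /memv_addP[t tZ [_ /vlineP[k ->] ->]].
  by rewrite raddfD /= ZcentL // linearZ /= ve scaler0 addr0.
have [b bB nbI] : exists2 b, b \in B & b \notin I.
  apply/subvPn/negP => BI; apply: nidB.
  by have /eqP-> : B == I by rewrite eqEdim BI dI dZ /=.
(* L acts on I / Z = <e> by a character; as Z is central in L, the Z-component
   of [y, e] is invisible to a further bracket. *)
have char_e y : exists k, forall x, lie x (lie y e) = k *: lie x e.
  have /memv_addv_lineP[k kZ] : lie y e \in (Z + <[e]>)%VS by rewrite -defI idI.
  exists k => x; rewrite -(subrK (k *: e) (lie y e)) raddfD /= ZcentL // add0r.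
  by rewrite linearZ.
have [[kb Ebe] [km Eme] [kz Eze]] := And3 (char_e b) (char_e m) (char_e z).
have bm0 : lie b m = 0 by rewrite abA // (subvP BA).
(* By the Jacobi identity, k_m b - k_b m and, once k_m = 0, k_z m - [m, z]
   centralise e, so that all of them are in I. *)
have : km *: b - kb *: m \in I.
  apply: cent_e; rewrite lieBl !lieZl -Ebe -Eme lie_derivation bm0.
  by rewrite (lieC 0) raddf0 oppr0 add0r subrr.
(* A nonzero [kb] would put [m] in [C]; then [km *: b] in [I] forces [km = 0]. *)
have [-> | kb0] := eqVneq kb 0; last first.
  move/(subvP IC); rewrite rpredBl; last by rewrite memvZ ?(subvP BC).
  by rewrite rpredZeq (negPf kb0) (negPf nmC).
rewrite scale0r subr0 rpredZeq (negPf nbI) orbF => /eqP km0.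
(* [z, m] = p + k z with p in [P]; if it were in [M], then k = 0 and [m] would lie in [C]. *)
have zmM : lie z m \notin M.
  apply: contra nmC => zmM; rewrite memC (subvP AM) //=.
  have : lie z m \in (P + <[z]>)%VS by rewrite idealCr ?(subvP (addvSr _ _)) ?memv_line.
  case/memv_addP => p pP [_ /vlineP[k ->]] zm; move: zmM; rewrite zm.
  rewrite (rpredDl _ (subvP PM _ pP)) rpredZeq (negPf nzM) orbF => /eqP->.
  by rewrite scale0r addr0.
case/negP: zmM; rewrite lieC memvN.
have /(subvP (subv_trans IC CM)) : kz *: m - lie m z \in I.
  apply: cent_e; rewrite lieBl lieZl -Eze lie_derivation Eme km0 scale0r.
  by rewrite addr0 subrr.
by rewrite rpredBl // memvZ // (subvP AM).
Qed.

End LieAlgebras.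

Theorem corollary3p6 (F : fieldType) (L : lieAlgType F) (n : nat)
    (dimL : \dim {:L} = n) (ssL : supersolvable L)
    (alphaL : (alpha L + 2 = n)%N) :
  (beta L + 2 = n)%N.
Proof.
have [[A [_ abA] dA] alpha_max] :=
  @max_dimP F L (fun A => subalgebra A /\ abelian_space A) (abelian_subalgebra0 L).
have [[J [idJ abJ] dJ] beta_max] :=
  @max_dimP F L (fun B => ideal B /\ abelian_space B) (abelian_ideal0 L).
have [|I [idI abI dI]] := codim2_abelian_ideal ssL abA.
  by rewrite dimL -alphaL dA addn2.
suffices -> : beta L = alpha L by [].
apply/eqP; rewrite eqn_leq; apply/andP; split.
  rewrite /beta -dJ; apply: alpha_max.
  by split=> // x y _; apply: idJ.
by rewrite /alpha -dA (leq_trans dI) //; apply: beta_max.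
Qed.
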